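(* Let $a,b,c,d,\theta_1,\theta_2\in(0,1)$ with $b+d<1$, and set $$(q,\alpha,\beta,\gamma,\delta)=\left(\frac{\theta_1}{\theta_2},\ \frac{(1-\theta_1)a}{\theta_2},\ \frac{(1-\theta_2)b}{\theta_2(1-b-d)},\ \frac{(1-\theta_2)c}{\theta_2},\ \frac{(1-\theta_1)d}{\theta_2(1-b-d)}\right).$$ Suppose $\mathbf D,\mathbf E$ are matrices, $\langle W|$ is a row vector and $|V\rangle$ is a column vector, of the same (possibly infinite) dimension, such that all admissible finite products of them are well-defined (convergent in the infinite-dimensional case) and associative, satisfying the DEHP algebra $$\mathbf D\mathbf E-q\,\mathbf E\mathbf D=\mathbf D+\mathbf E,\qquad \langle W|(\alpha\mathbf E-\gamma\mathbf D)=\langle W|,\qquad(\beta\mathbf D-\delta\mathbf E)|V\rangle=|V\rangle.$$ Then the matrices $$D^\uparrow=\frac{1-\theta_2}{\theta_2}\mathbf D,\qquad E^\uparrow=\frac{1-\theta_1}{\theta_2}\mathbf E,\qquad D^\rightarrow=D^\uparrow+I,\qquad E^\rightarrow=E^\uparrow-I,$$ together with $\langle W|$ and $|V\rangle$, satisfy $$D^\uparrow D^\rightarrow=D^\rightarrow D^\uparrow,\qquad E^\uparrow E^\rightarrow=E^\rightarrow E^\uparrow,$$ $$D^\uparrow E^\rightarrow=(1-\theta_2)D^\rightarrow E^\uparrow+\theta_1E^\rightarrow D^\uparrow,\qquad E^\uparrow D^\rightarrow=\theta_2D^\rightarrow E^\uparrow+(1-\theta_1)E^\rightarrow D^\uparrow,$$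 $$\langle W|D^\rightarrow=(1-c)\langle W|D^\uparrow+a\langle W|E^\uparrow,\qquad \langle W|E^\rightarrow=(1-a)\langle W|E^\uparrow+c\langle W|D^\uparrow,$$ $$D^\uparrow|V\rangle=(1-b)D^\rightarrow|V\rangle+dE^\rightarrow|V\rangle,\qquad E^\uparrow|V\rangle=(1-d)E^\rightarrow|V\rangle+bD^\rightarrow|V\rangle.$$
   Context: $I$ denotes the identity matrix of the same dimension as $\mathbf D$ and $\mathbf E$. The superscripts $\uparrow,\rightarrow$ are just labels distinguishing the four matrices. *)

(* Defs.v *)
From mathcomp Require Import all_boot all_order all_algebra.
From mathcomp Require Import boolp classical_sets functions topology.
From mathcomp Require Import normedtype sequences.

Set Implicit Arguments.
Unset Strict Implicit.
Unset Printing Implicit Defensive.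

Import Order.TTheory GRing.Theory Num.Theory.
Import numFieldNormedType.Exports.

Local Open Scope classical_set_scope.
Local Open Scope ring_scope.

(* Matrices of possibly infinite size over a numFieldType [K], which may be    *)
(* the field of real numbers or of complex numbers.  The ordered structure of  *)
(* [K] is such that [0 < x < 1] forces [x] to be real.                         *)

Inductive mdim := Fin of nat | Inf.

Definition midx (n : mdim) : eqType :=
  match n with Fin k => 'I_k | Inf => nat end.

(* Sums, scalar multiples and equality are the pointwise ones of functions;    *)
(* [K^o] is [K] as a module over itself.                                       *)
Definition mat (K : numFieldType) (m n : mdim) : Type :=
  midx m -> midx n -> K^o.

Definition idmat (K : numFieldType) (n : mdim) : mat K n n :=
  fun i j => (i == j)%:R.
Arguments idmat : clear implicits.

Definition msummable (K : numFieldType) (n : mdim) : (midx n -> K) -> Prop :=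
  match n with
  | Fin _ => fun _ => True
  | Inf => fun f => cvgn (series f)
  end.

(* Arbitrary when [f] is not summable. *)
Definition msum (K : numFieldType) (n : mdim) : (midx n -> K) -> K :=
  match n with
  | Fin _ => fun f => \sum_i f i
  | Inf => fun f => limn (series f)
  end.

Definition mulmat (K : numFieldType) (m n p : mdim)
    (A : mat K m n) (B : mat K n p) : mat K m p :=
  fun i k => msum (fun j => A i j * B j k).

Definition mul_converges (K : numFieldType) (m n p : mdim)
    (A : mat K m n) (B : mat K n p) : Prop :=
  forall i k, msummable (fun j => A i j * B j k).

Notation "A ** B" := (mulmat A B) (at level 40, left associativity).

Section DEHP.
Variables (K : numFieldType) (N : mdim).
Variables (D E : mat K N N) (W : mat K (Fin 1) N) (V : mat K N (Fin 1)).

(* All bracketed products of the four factors whose dimensions match; only    *)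
(* meaningful together with [products_converge], as [**] is a total operation. *)
Inductive bracketed_product : forall m n, mat K m n -> Prop :=
| product_D : bracketed_product D
| product_E : bracketed_product E
| product_W : bracketed_product W
| product_V : bracketed_product V
| product_mul m n p (A : mat K m n) (B : mat K n p) :
    bracketed_product A -> bracketed_product B -> bracketed_product (A ** B).

Definition products_converge : Prop :=
  forall m n p (A : mat K m n) (B : mat K n p),
    bracketed_product A -> bracketed_product B -> mul_converges A B.

Definition products_associative : Prop :=
  forall m n p r (A : mat K m n) (B : mat K n p) (C : mat K p r),
    bracketed_product A -> bracketed_product B -> bracketed_product C ->
    A ** B ** C = A ** (B ** C).

Definition DEHP_algebra (q alpha beta gamma delta : K) : Prop :=
  [/\ D ** E - q *: (E ** D) = D + E,
      W ** (alpha *: E - gamma *: D) = W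
    & (beta *: D - delta *: E) ** V = V].

End DEHP.

(* Main.v *)
Require Import Defs.
From mathcomp Require Import all_boot all_order all_algebra.
From mathcomp Require Import boolp classical_sets functions topology.
From mathcomp Require Import normedtype sequences.
From mathcomp Require Import ring.

Set Implicit Arguments.
Unset Strict Implicit.
Unset Printing Implicit Defensive.

Import Order.TTheory GRing.Theory Num.Theory.
Import numFieldNormedType.Exports.

Local Open Scope classical_set_scope.
Local Open Scope ring_scope.

(** The hypotheses are the rescaled DEHP relations.  In terms of
    [Du = (1 - theta2) / theta2 *: D] and [Eu = (1 - theta1) / theta2 *: E]
    they read
      theta2 Du Eu - theta1 Eu Du = (1 - theta1) Du + (1 - theta2) Eu,
      a W Eu - c W Du = W,   b Du V - d Eu V = (1 - b - d) V,
    and expanding [Dright = Du + I], [Eright = Eu - I] in each conclusion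
    turns it into a multiple of one of these three relations (the two
    commutation identities being automatic, as [I] commutes with everything).

    In infinite dimension each expansion distributes a product over a sum,
    which is legitimate only when the separate products converge.
    Convergence and value are therefore carried together by the relation
    [product_is A B C], which is stable under linear combinations on either
    side and holds for products with the identity. *)

(** * Linearity of possibly infinite sums *)

(** Convergence and value are kept together because [msum] is an arbitrary
    value on a divergent series. *)
Definition sum_is (K : numFieldType) (n : mdim) (f : midx n -> K) (s : K) :=
  msummable f /\ msum f = s.

Lemma sum_is_Inf (K : numFieldType) (f : midx Inf -> K) (s : K) :
  sum_is f s <-> series f @ \oo --> s.
Proof.
split=> [[cf <-] //|fs]; split; first by apply/cvg_ex; exists s.
exact: cvg_lim.
Qed.

Lemma sum_isD (K : numFieldType) (n : mdim) (f g : midx n -> K) (s t : K) :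
  sum_is f s -> sum_is g t -> sum_is (fun j => f j + g j) (s + t).
Proof.
case: n f g => [n f g [_ <-] [_ <-]|f g]; first by split; rewrite //= big_split.
move=> /sum_is_Inf fs /sum_is_Inf gt; apply/sum_is_Inf.
have -> : series (fun j => f j + g j) = series f \+ series g.
  by apply/funext => m; rewrite /series /= big_split.
exact: cvgD.
Qed.

Lemma sum_isZ (K : numFieldType) (n : mdim) (f : midx n -> K) (x s : K) :
  sum_is f s -> sum_is (fun j => x * f j) (x * s).
Proof.
case: n f => [n f [_ <-]|f]; first by split; rewrite //= mulr_sumr.
move=> /sum_is_Inf fs; apply/sum_is_Inf.
have -> : series (fun j => x * f j) = (fun m => x * series f m).
  by apply/funext => m; rewrite /series /= mulr_sumr.
exact: cvgMr.
Qed.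

(** A family supported at one index is summable: its partial sums are
    eventually constant. *)
Lemma sum_is_single (K : numFieldType) (n : mdim) (f : midx n -> K)
    (i : midx n) :
  (forall j, j != i -> f j = 0) -> sum_is f (f i).
Proof.
case: n f i => [n f i f0|f i f0].
  by split=> //=; rewrite (bigD1 i) //= big1 ?addr0.
apply/sum_is_Inf; apply: cvg_near_cst; exists i.+1 => // m /= lt_im.
rewrite /series /= (bigD1_seq i) ?mem_index_iota ?iota_uniq //=.
by rewrite big1 ?addr0.
Qed.

(** * Linearity of matrix products *)

Definition product_is (K : numFieldType) (m n p : mdim)
    (A : mat K m n) (B : mat K n p) (C : mat K m p) :=
  mul_converges A B /\ A ** B = C.

Lemma product_isP (K : numFieldType) (m n p : mdim)
    (A : mat K m n) (B : mat K n p) (C : mat K m p) :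
  product_is A B C <-> forall i k, sum_is (fun j => A i j * B j k) (C i k).
Proof.
split=> [[cAB <-] i k|AB]; first by split; first exact: cAB.
split=> [i k|]; first by case: (AB i k).
by apply/funext => i; apply/funext => k; case: (AB i k).
Qed.

Lemma product_isDl (K : numFieldType) (m n p : mdim)
    (A A' : mat K m n) (B : mat K n p) (C C' : mat K m p) :
  product_is A B C -> product_is A' B C' -> product_is (A + A') B (C + C').
Proof.
move=> /product_isP h /product_isP h'; apply/product_isP => i k.
have := sum_isD (h i k) (h' i k); congr sum_is.
by apply/funext => j; rewrite -mulrDl.
Qed.

Lemma product_isDr (K : numFieldType) (m n p : mdim)
    (A : mat K m n) (B B' : mat K n p) (C C' : mat K m p) :
  product_is A B C -> product_is A B' C' -> product_is A (B + B') (C + C').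
Proof.
move=> /product_isP h /product_isP h'; apply/product_isP => i k.
have := sum_isD (h i k) (h' i k); congr sum_is.
by apply/funext => j; rewrite -mulrDr.
Qed.

Lemma product_isZl (K : numFieldType) (m n p : mdim) (x : K)
    (A : mat K m n) (B : mat K n p) (C : mat K m p) :
  product_is A B C -> product_is (x *: A) B (x *: C).
Proof.
move=> /product_isP h; apply/product_isP => i k.
have := sum_isZ x (h i k); congr sum_is.
by apply/funext => j; rewrite mulrA.
Qed.

Lemma product_isZr (K : numFieldType) (m n p : mdim) (x : K)
    (A : mat K m n) (B : mat K n p) (C : mat K m p) :
  product_is A B C -> product_is A (x *: B) (x *: C).
Proof.
move=> /product_isP h; apply/product_isP => i k.
have := sum_isZ x (h i k); congr sum_is.
by apply/funext => j; rewrite mulrCA.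
Qed.

Lemma product_isNl (K : numFieldType) (m n p : mdim)
    (A : mat K m n) (B : mat K n p) (C : mat K m p) :
  product_is A B C -> product_is (- A) B (- C).
Proof. by move=> h; rewrite -(scaleN1r A) -(scaleN1r C); apply: product_isZl. Qed.

Lemma product_isNr (K : numFieldType) (m n p : mdim)
    (A : mat K m n) (B : mat K n p) (C : mat K m p) :
  product_is A B C -> product_is A (- B) (- C).
Proof. by move=> h; rewrite -(scaleN1r B) -(scaleN1r C); apply: product_isZr. Qed.

Lemma product_is1l (K : numFieldType) (n p : mdim) (B : mat K n p) :
  product_is (idmat K n) B B.
Proof.
apply/product_isP => i k; rewrite -[B i k]mul1r -[1]/(true%:R) -(eqxx i).
apply: (@sum_is_single K n (fun j => (i == j)%:R * B j k)) => j.
by rewrite eq_sym => /negPf ->; rewrite mul0r.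
Qed.

Lemma product_is1r (K : numFieldType) (m n : mdim) (A : mat K m n) :
  product_is A (idmat K n) A.
Proof.
apply/product_isP => i k; rewrite -[A i k]mulr1 -[1]/(true%:R) -(eqxx k).
apply: (@sum_is_single K n (fun j => A i j * (j == k)%:R)) => j.
by move=> /negPf ->; rewrite mulr0.
Qed.

(** The left factors, and the right factors, with which the products of a
    fixed matrix converge form a submodule containing the identity. *)
Lemma mul_converges_addl (K : numFieldType) (m n p : mdim)
    (A A' : mat K m n) (B : mat K n p) :
  mul_converges A B -> mul_converges A' B -> mul_converges (A + A') B.
Proof. by move=> h h'; case: (product_isDl (conj h erefl) (conj h' erefl)). Qed.

Lemma mul_converges_addr (K : numFieldType) (m n p : mdim)
    (A : mat K m n) (B B' : mat K n p) :
  mul_converges A B -> mul_converges A B' -> mul_converges A (B + B').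
Proof. by move=> h h'; case: (product_isDr (conj h erefl) (conj h' erefl)). Qed.

Lemma mul_converges_scalel (K : numFieldType) (m n p : mdim) (x : K)
    (A : mat K m n) (B : mat K n p) :
  mul_converges A B -> mul_converges (x *: A) B.
Proof. by move=> h; case: (product_isZl x (conj h erefl)). Qed.

Lemma mul_converges_scaler (K : numFieldType) (m n p : mdim) (x : K)
    (A : mat K m n) (B : mat K n p) :
  mul_converges A B -> mul_converges A (x *: B).
Proof. by move=> h; case: (product_isZr x (conj h erefl)). Qed.

Lemma mulmatZl (K : numFieldType) (m n p : mdim) (x : K)
    (A : mat K m n) (B : mat K n p) :
  mul_converges A B -> (x *: A) ** B = x *: (A ** B).
Proof. by move=> h; case: (product_isZl x (conj h erefl)). Qed.

Lemma mulmatZr (K : numFieldType) (m n p : mdim) (x : K)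
    (A : mat K m n) (B : mat K n p) :
  mul_converges A B -> A ** (x *: B) = x *: (A ** B).
Proof. by move=> h; case: (product_isZr x (conj h erefl)). Qed.

Lemma mulmatBl (K : numFieldType) (m n p : mdim)
    (A A' : mat K m n) (B : mat K n p) :
  mul_converges A B -> mul_converges A' B -> (A - A') ** B = A ** B - A' ** B.
Proof.
by move=> h h'; case: (product_isDl (conj h erefl) (product_isNl (conj h' erefl))).
Qed.

Lemma mulmatBr (K : numFieldType) (m n p : mdim)
    (A : mat K m n) (B B' : mat K n p) :
  mul_converges A B -> mul_converges A B' -> A ** (B - B') = A ** B - A ** B'.
Proof.
by move=> h h'; case: (product_isDr (conj h erefl) (product_isNr (conj h' erefl))).
Qed.

Lemma mulmat_addIl (K : numFieldType) (n p : mdim)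
    (A : mat K n n) (B : mat K n p) :
  mul_converges A B -> (A + idmat K n) ** B = A ** B + B.
Proof. by move=> h; case: (product_isDl (conj h erefl) (product_is1l B)). Qed.

Lemma mulmat_addIr (K : numFieldType) (m n : mdim)
    (A : mat K m n) (B : mat K n n) :
  mul_converges A B -> A ** (B + idmat K n) = A ** B + A.
Proof. by move=> h; case: (product_isDr (conj h erefl) (product_is1r A)). Qed.

Lemma mulmat_subIl (K : numFieldType) (n p : mdim)
    (A : mat K n n) (B : mat K n p) :
  mul_converges A B -> (A - idmat K n) ** B = A ** B - B.
Proof.
by move=> h; case: (product_isDl (conj h erefl) (product_isNl (product_is1l B))).
Qed.

Lemma mulmat_subIr (K : numFieldType) (m n : mdim)
    (A : mat K m n) (B : mat K n n) :
  mul_converges A B -> A ** (B - idmat K n) = A ** B - A.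
Proof.
by move=> h; case: (product_isDr (conj h erefl) (product_isNr (product_is1r A))).
Qed.

Lemma addmatE (K : numFieldType) (m n : mdim) (A B : mat K m n) i k :
  (A + B) i k = A i k + B i k :> K.
Proof. by []. Qed.

Lemma oppmatE (K : numFieldType) (m n : mdim) (A : mat K m n) i k :
  (- A) i k = - A i k :> K.
Proof. by []. Qed.

Lemma scalematE (K : numFieldType) (m n : mdim) (x : K) (A : mat K m n) i k :
  (x *: A) i k = x * A i k :> K.
Proof. by []. Qed.

Definition matE := (addmatE, oppmatE, scalematE).

(** Reduces a matrix identity that is a multiple of a known one to a
    polynomial identity between entries. *)
Lemma mat_eq_from (K : numFieldType) (m n : mdim) (x : K)
    (A B : mat K m n) (L R : mat K m n) :
  L = R ->
  (forall i k, A i k - B i k = x * (L i k - R i k) :> K) -> A = B.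
Proof.
move=> -> AB; apply/funext => i; apply/funext => k.
by apply: subr0_eq; rewrite [LHS]AB subrr mulr0.
Qed.

(** * The DEHP relations after rescaling *)

Unset Implicit Arguments.

Theorem theorem2p9 (K : numFieldType) (a b c d theta1 theta2 : K)
    (ha : 0 < a < 1) (hb : 0 < b < 1) (hc : 0 < c < 1) (hd : 0 < d < 1)
    (htheta1 : 0 < theta1 < 1) (htheta2 : 0 < theta2 < 1) (hbd : b + d < 1)
    (q alpha beta gamma delta : K)
    (hq : q = theta1 / theta2)
    (halpha : alpha = (1 - theta1) * a / theta2)
    (hbeta : beta = (1 - theta2) * b / (theta2 * (1 - b - d)))
    (hgamma : gamma = (1 - theta2) * c / theta2)
    (hdelta : delta = (1 - theta1) * d / (theta2 * (1 - b - d)))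
    (N : mdim) (D E : mat K N N) (W : mat K (Fin 1) N) (V : mat K N (Fin 1))
    (hconv : products_converge D E W V)
    (hassoc : products_associative D E W V)
    (hDEHP : DEHP_algebra D E W V q alpha beta gamma delta)
    (Dup Eup Dright Eright : mat K N N)
    (hDup : Dup = ((1 - theta2) / theta2) *: D)
    (hEup : Eup = ((1 - theta1) / theta2) *: E)
    (hDright : Dright = Dup + idmat K N)
    (hEright : Eright = Eup - idmat K N) :
  (* every product occurring in the identities below converges *)
  [/\ forall A B : mat K N N,
        [set Dup; Eup; Dright; Eright] A -> [set Dup; Eup; Dright; Eright] B ->
        mul_converges A B,
      forall A : mat K N N, [set Dup; Eup; Dright; Eright] A -> mul_converges W A
    & forall A : mat K N N, [set Dup; Eup; Dright; Eright] A -> mul_converges A V]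
  /\
  [/\ Dup ** Dright = Dright ** Dup,
      Eup ** Eright = Eright ** Eup,
      Dup ** Eright =
        (1 - theta2) *: (Dright ** Eup) + theta1 *: (Eright ** Dup)
    & Eup ** Dright =
        theta2 *: (Dright ** Eup) + (1 - theta1) *: (Eright ** Dup)]
  /\
  [/\ W ** Dright = (1 - c) *: (W ** Dup) + a *: (W ** Eup)
    & W ** Eright = (1 - a) *: (W ** Eup) + c *: (W ** Dup)]
  /\
  [/\ Dup ** V = (1 - b) *: (Dright ** V) + d *: (Eright ** V)
    & Eup ** V = (1 - d) *: (Eright ** V) + b *: (Dright ** V)].
Proof.
have t2 : theta2 != 0 by case/andP: htheta2 => /gt_eqF ->.
have bd : 1 - b - d != 0 by rewrite gt_eqF // -addrA -opprD subr_gt0.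
have [bD bE bW bV] : [/\ bracketed_product D E W V D,
    bracketed_product D E W V E, bracketed_product D E W V W
    & bracketed_product D E W V V] by split; constructor.
have [cWD cWE cDV cEV] : [/\ mul_converges W D, mul_converges W E,
    mul_converges D V & mul_converges E V] by split; apply: hconv.
have [relDE relW relV] := hDEHP.
(* The four matrices are linear combinations of [D], [E] and the identity,
   so any convergence statement linear in one factor extends to them. *)
have four_in (P : mat K N N -> Prop) :
    (forall A B, P A -> P B -> P (A + B)) -> (forall x A, P A -> P (x *: A)) ->
    P D -> P E -> P (idmat K N) ->
    forall A, [set Dup; Eup; Dright; Eright] A -> P A.
  move=> PD PZ Dp Ep Ip A.
  have Dup_p : P Dup by rewrite hDup; apply: PZ.
  have Eup_p : P Eup by rewrite hEup; apply: PZ.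
  case=> [[[->|->]|->]|->] //; first by rewrite hDright; apply: PD.
  by rewrite hEright -scaleN1r; apply: PD => //; apply: PZ.
have conv_l (p : mdim) (B : mat K N p) : mul_converges D B -> mul_converges E B ->
    forall A, [set Dup; Eup; Dright; Eright] A -> mul_converges A B.
  move=> DB EB; apply: four_in => //.
  - by move=> A A'; apply: mul_converges_addl.
  - by move=> x A; apply: mul_converges_scalel.
  - by case: (product_is1l B).
have conv_r (m : mdim) (A : mat K m N) : mul_converges A D -> mul_converges A E ->
    forall B, [set Dup; Eup; Dright; Eright] B -> mul_converges A B.
  move=> AD AE; apply: four_in => //.
  - by move=> B B'; apply: mul_converges_addr.
  - by move=> x B; apply: mul_converges_scaler.
  - by case: (product_is1r A).
have convM A B : [set Dup; Eup; Dright; Eright] A ->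
    [set Dup; Eup; Dright; Eright] B -> mul_converges A B.
  move=> hA hB; move: A hA; apply: conv_l; move: B hB; apply: conv_r;
    exact: hconv.
have convW := conv_r _ W cWD cWE.
have convV := conv_l _ V cDV cEV.
split; first by split.
have [inD inE] : [set Dup; Eup; Dright; Eright] Dup /\
    [set Dup; Eup; Dright; Eright] Eup by split; do 2 left; [left|right].
(* The hypotheses turn into the relations for the rescaled matrices; each
   constant below is the ratio between the two normalizations. *)
have cDE := hconv _ _ _ _ _ bD bE.
have cED := hconv _ _ _ _ _ bE bD.
have bulk : theta2 *: (Dup ** Eup) - theta1 *: (Eup ** Dup) =
    (1 - theta1) *: Dup + (1 - theta2) *: Eup.
  rewrite hDup hEup !(mulmatZl, mulmatZr) //; try exact: mul_converges_scaler.
  apply: (mat_eq_from (x := (1 - theta1) * (1 - theta2) / theta2) relDE) => i k.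
  by rewrite hq !matE; field.
have left_boundary : a *: (W ** Eup) - c *: (W ** Dup) = W.
  move: relW; rewrite mulmatBr ?mulmatZr //; try exact: mul_converges_scaler.
  move=> relW'; rewrite hDup hEup !mulmatZr //.
  apply: (mat_eq_from (x := 1) relW') => i k.
  by rewrite halpha hgamma !matE; field.
have right_boundary : b *: (Dup ** V) - d *: (Eup ** V) = (1 - b - d) *: V.
  move: relV; rewrite mulmatBl ?mulmatZl //; try exact: mul_converges_scalel.
  move=> relV'; rewrite hDup hEup !mulmatZl //.
  apply: (mat_eq_from (x := 1 - b - d) relV') => i k.
  by rewrite hbeta hdelta !matE; field; rewrite bd t2.
(* Every remaining identity is now, up to sign, one of [bulk],
   [left_boundary] and [right_boundary]. *)
have [cDD cEE] := (convM _ _ inD inD, convM _ _ inE inE).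
have [cDE' cED'] := (convM _ _ inD inE, convM _ _ inE inD).
have [cWD' cWE'] := (convW _ inD, convW _ inE).
have [cDV' cEV'] := (convV _ inD, convV _ inE).
rewrite hDright hEright !(mulmat_addIl, mulmat_addIr, mulmat_subIl, mulmat_subIr) //.
split; last split.
- split=> //.
  + apply: (mat_eq_from (x := 1) bulk) => i k; rewrite !matE; ring.
  + apply: (mat_eq_from (x := -1) bulk) => i k; rewrite !matE; ring.
- split.
  + apply: (mat_eq_from (x := -1) left_boundary) => i k; rewrite !matE; ring.
  + apply: (mat_eq_from (x := 1) left_boundary) => i k; rewrite !matE; ring.
- split.
  + apply: (mat_eq_from (x := 1) right_boundary) => i k; rewrite !matE; ring.
  + apply: (mat_eq_from (x := -1) right_boundary) => i k; rewrite !matE; ring.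
Qed.
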